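(* Let $\mathcal{C}$ be a braided tensor category, and let $\mathcal{M}$ be a tensor category with unit $\mathbf{1}_{\mathcal{M}}$ that is also a left $\mathcal{C}$-module category, equipped with natural associativity isomorphisms $$\mathcal{A}_{\mathsf{X},\mathsf{M}_1,\mathsf{M}_2}:\mathsf{X}\otimes(\mathsf{M}_1\otimes_{\mathcal{M}}\mathsf{M}_2)\to(\mathsf{X}\otimes\mathsf{M}_1)\otimes_{\mathcal{M}}\mathsf{M}_2\qquad(\mathsf{X}\in\mathrm{Obj}(\mathcal{C}),\ \mathsf{M}_1,\mathsf{M}_2\in\mathrm{Obj}(\mathcal{M}))$$ such that all associativity and unit isomorphisms are compatible in the sense that all triangle and pentagon diagrams commute. Assume that the functor $\mathsf{X}\mapsto\mathrm{Hom}_{\mathcal{M}}(\mathsf{X}\otimes\mathbf{1}_{\mathcal{M}},\mathbf{1}_{\mathcal{M}})$ is representable, with representing object $\mathsf{A}=\underline{\mathrm{Hom}}(\mathbf{1}_{\mathcal{M}},\mathbf{1}_{\mathcal{M}})$ and natural isomorphisms $\lambda_{\mathsf{X}}:\mathrm{Hom}_{\mathcal{M}}(\mathsf{X}\otimes\mathbf{1}_{\mathcal{M}},\mathbf{1}_{\mathcal{M}})\to\mathrm{Hom}_{\mathcal{C}}(\mathsf{X},\mathsf{A})$, and that the induction functor $\mathcal{F}:\mathcal{C}\to\mathcal{M}$, $\mathsf{X}\mapsto\mathsf{X}\otimes\mathbf{1}_{\mathcal{M}}$, is a central functor. Then the multiplication $$m=\lambda_{\mathsf{A}\otimes\mathsf{A}}\Big(\lambda_{\mathsf{A}}^{-1}(\mathrm{Id}_{\mathsf{A}})\circ\big(\mathrm{Id}_{\mathsf{A}}\otimes\lambda_{\mathsf{A}}^{-1}(\mathrm{Id}_{\mathsf{A}})\big)\circ\mathcal{A}_{\mathsf{A},\mathsf{A},\mathbf{1}_{\mathcal{M}}}^{-1}\Big)$$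 on $\mathsf{A}$ is commutative, that is, $m\circ\mathcal{R}_{\mathsf{A},\mathsf{A}}=m$.
   Context: Categories are $\mathbb F$-linear abelian ($\mathbb F$ a field); a tensor category is monoidal with bilinear $\otimes$, unit isomorphisms $l,r$, associativity isomorphisms $\mathcal A_{\mathsf X,\mathsf Y,\mathsf Z}:\mathsf X\otimes(\mathsf Y\otimes\mathsf Z)\to(\mathsf X\otimes\mathsf Y)\otimes\mathsf Z$; no rigidity, finiteness or semisimplicity is assumed. $\mathcal R$ is the braiding of $\mathcal C$. A left $\mathcal C$-module category has natural isomorphisms $\mathcal A_{\mathsf X_1,\mathsf X_2,\mathsf M}:\mathsf X_1\otimes(\mathsf X_2\otimes\mathsf M)\to(\mathsf X_1\otimes\mathsf X_2)\otimes\mathsf M$ and $l_{\mathsf M}:\mathbf 1\otimes\mathsf M\to\mathsf M$ satisfying pentagon and triangle axioms. Naturality of $\lambda$: $\lambda_{\mathsf X}(g\circ(f\otimes\mathrm{Id}))=\lambda_{\mathsf Y}(g)\circ f$ for $f:\mathsf X\to\mathsf Y$. $\mathcal F$ is a tensor functor with structure isomorphism $\mathcal F(\mathsf X_1\otimes\mathsf X_2)\to\mathcal F(\mathsf X_1)\otimes\mathcal F(\mathsf X_2)$ given by $\mathcal A_{\mathsf X_1,\mathbf 1_{\mathcal M},\mathsf X_2\otimes\mathbf 1_{\mathcal M}}\circ(\mathrm{Id}_{\mathsf X_1}\otimes l^{-1}_{\mathsf X_2\otimes\mathbf 1_{\mathcal M}})\circ\mathcal A^{-1}_{\mathsf X_1,\mathsf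 X_2,\mathbf 1_{\mathcal M}}$. The center $\mathcal Z(\mathcal M)$ has objects $(\mathsf X,\gamma^{\mathsf X})$, where $\gamma^{\mathsf X}=\{\gamma^{\mathsf X}_{\mathsf N}:\mathsf N\otimes\mathsf X\to\mathsf X\otimes\mathsf N\}_{\mathsf N\in\mathcal M}$ is a family of isomorphisms natural in $\mathsf N$ with $\mathcal A_{\mathsf X,\mathsf Y,\mathsf Z}\circ\gamma^{\mathsf X}_{\mathsf Y\otimes\mathsf Z}\circ\mathcal A_{\mathsf Y,\mathsf Z,\mathsf X}=(\gamma^{\mathsf X}_{\mathsf Y}\otimes\mathrm{Id}_{\mathsf Z})\circ\mathcal A_{\mathsf Y,\mathsf X,\mathsf Z}\circ(\mathrm{Id}_{\mathsf Y}\otimes\gamma^{\mathsf X}_{\mathsf Z})$; morphisms $f:(\mathsf X,\gamma^{\mathsf X})\to(\mathsf Y,\gamma^{\mathsf Y})$ are morphisms $f:\mathsf X\to\mathsf Y$ with $\gamma^{\mathsf Y}_{\mathsf N}\circ(\mathrm{Id}_{\mathsf N}\otimes f)=(f\otimes\mathrm{Id}_{\mathsf N})\circ\gamma^{\mathsf X}_{\mathsf N}$. It is braided tensor with $(\mathsf X,\gamma^{\mathsf X})\otimes(\mathsf Y,\gamma^{\mathsf Y})=(\mathsf X\otimes\mathsf Y,\gamma^{\mathsf X\otimes\mathsf Y})$, $\gamma^{\mathsf X\otimes\mathsf Y}_{\mathsf N}=\mathcal A_{\mathsf X,\mathsf Y,\mathsf N}(\mathrm{Id}_{\mathsf X}\otimes\gamma^{\mathsf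 Y}_{\mathsf N})\mathcal A^{-1}_{\mathsf X,\mathsf N,\mathsf Y}(\gamma^{\mathsf X}_{\mathsf N}\otimes\mathrm{Id}_{\mathsf Y})\mathcal A_{\mathsf N,\mathsf X,\mathsf Y}$, and braiding $\mathcal R_{(\mathsf X,\gamma^{\mathsf X}),(\mathsf Y,\gamma^{\mathsf Y})}=\gamma^{\mathsf Y}_{\mathsf X}$. A tensor functor $\mathcal F:\mathcal C\to\mathcal M$ from a braided tensor category is central if there is a braided tensor functor $\mathcal G:\mathcal C\to\mathcal Z(\mathcal M)$ with $\mathcal F=\mathcal I\circ\mathcal G$ (as tensor functors), $\mathcal I:\mathcal Z(\mathcal M)\to\mathcal M$ the forgetful functor. *)

(* Defs.v *)
From HB Require Import structures.
From mathcomp Require Import all_boot all_algebra.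
From mathcomp.classical Require Import boolp.
Set Implicit Arguments.
Unset Strict Implicit.
Unset Printing Implicit Defensive.
Import GRing.Theory.
Local Open Scope ring_scope.

Declare Scope cat_scope.
Delimit Scope cat_scope with cat.
Local Open Scope cat_scope.

Reserved Notation "g ∘ f" (at level 38, right associativity).
Reserved Notation "X ⊗ Y" (at level 35, right associativity).
Reserved Notation "f [⊗] g" (at level 35, right associativity).


Record linCat (k : fieldType) := LinCat {
  Ob :> Type;
  Mor : Ob -> Ob -> lmodType k;
  idm : forall X, Mor X X;
  mcomp : forall X Y Z, Mor Y Z -> Mor X Y -> Mor X Z;
  mcomp1m : forall X Y (f : Mor X Y), mcomp (idm Y) f = f;
  mcompm1 : forall X Y (f : Mor X Y), mcomp f (idm X) = f;
  mcompA : forall W X Y Z (h : Mor Y Z) (g : Mor X Y) (f : Mor W X),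
    mcomp (mcomp h g) f = mcomp h (mcomp g f);
  mcomp_linl : forall X Y Z (f : Mor X Y), linear (fun g : Mor Y Z => mcomp g f);
  mcomp_linr : forall X Y Z (g : Mor Y Z), linear (fun f : Mor X Y => mcomp g f) }.

Arguments Mor {k l} X Y : rename.
Arguments idm {k l} X : rename.
Notation "g ∘ f" := (mcomp g f) : cat_scope.

Section Abelian.
Context {k : fieldType} {C : linCat k}.
Implicit Types X Y Z W P K : C.

Definition is_zero_object Z :=
  forall X, (forall f : Mor X Z, f = 0) /\ (forall f : Mor Z X, f = 0).

Definition is_biproduct X Y P
    (i1 : Mor X P) (i2 : Mor Y P) (p1 : Mor P X) (p2 : Mor P Y) :=
  [/\ p1 ∘ i1 = idm X, p2 ∘ i2 = idm Y, p1 ∘ i2 = 0, p2 ∘ i1 = 0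
    & i1 ∘ p1 + i2 ∘ p2 = idm P].

Definition is_kernel X Y K (f : Mor X Y) (i : Mor K X) :=
  f ∘ i = 0 /\
  forall W (h : Mor W X), f ∘ h = 0 -> exists! u : Mor W K, i ∘ u = h.

Definition is_cokernel X Y K (f : Mor X Y) (p : Mor Y K) :=
  p ∘ f = 0 /\
  forall W (h : Mor Y W), h ∘ f = 0 -> exists! u : Mor K W, u ∘ p = h.

Definition is_mono X Y (f : Mor X Y) :=
  forall W (g h : Mor W X), f ∘ g = f ∘ h -> g = h.

Definition is_epi X Y (f : Mor X Y) :=
  forall W (g h : Mor Y W), g ∘ f = h ∘ f -> g = h.

End Abelian.

Record abelianCat (k : fieldType) (C : linCat k) : Prop := AbelianCat {
  ab_zero : exists Z : C, is_zero_object Z;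
  ab_biproduct : forall X Y : C, exists (P : C) (i1 : Mor X P) (i2 : Mor Y P)
    (p1 : Mor P X) (p2 : Mor P Y), is_biproduct i1 i2 p1 p2;
  ab_kernel : forall (X Y : C) (f : Mor X Y),
    exists (K : C) (i : Mor K X), is_kernel f i;
  ab_cokernel : forall (X Y : C) (f : Mor X Y),
    exists (K : C) (p : Mor Y K), is_cokernel f p;
  ab_mono_normal : forall (K X : C) (i : Mor K X), is_mono i ->
    exists (Y : C) (f : Mor X Y), is_kernel f i;
  ab_epi_normal : forall (Y K : C) (p : Mor Y K), is_epi p ->
    exists (X : C) (f : Mor X Y), is_cokernel f p }.

Record iso (k : fieldType) (C : linCat k) (X Y : C) := Iso {
  iso_mor :> Mor X Y;
  iso_inv : Mor Y X;
  isoK : iso_inv ∘ iso_mor = idm X;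
  isoVK : iso_mor ∘ iso_inv = idm Y }.

Notation "i ⁻¹" := (iso_inv i) (at level 3, left associativity, format "i ⁻¹") : cat_scope.


Record monCat (k : fieldType) := MonCat {
  mon_lin :> linCat k;
  tens : mon_lin -> mon_lin -> mon_lin;
  tensm : forall X X' Y Y' : mon_lin,
    Mor X X' -> Mor Y Y' -> Mor (tens X Y) (tens X' Y');
  tens_id : forall X Y, tensm (idm X) (idm Y) = idm (tens X Y);
  tens_comp : forall X X' X'' Y Y' Y''
    (f' : Mor X' X'') (f : Mor X X') (g' : Mor Y' Y'') (g : Mor Y Y'),
    tensm (f' ∘ f) (g' ∘ g) = tensm f' g' ∘ tensm f g;
  tens_linl : forall X X' Y Y' (g : Mor Y Y'),
    linear (fun f : Mor X X' => tensm f g);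
  tens_linr : forall X X' Y Y' (f : Mor X X'),
    linear (fun g : Mor Y Y' => tensm f g);
  unit_ob : mon_lin;
  lunit : forall X, iso (tens unit_ob X) X;
  runit : forall X, iso (tens X unit_ob) X;
  assoc : forall X Y Z, iso (tens X (tens Y Z)) (tens (tens X Y) Z);
  lunit_nat : forall X Y (f : Mor X Y),
    lunit Y ∘ tensm (idm unit_ob) f = f ∘ lunit X;
  runit_nat : forall X Y (f : Mor X Y),
    runit Y ∘ tensm f (idm unit_ob) = f ∘ runit X;
  assoc_nat : forall X X' Y Y' Z Z'
    (f : Mor X X') (g : Mor Y Y') (h : Mor Z Z'),
    assoc X' Y' Z' ∘ tensm f (tensm g h) = tensm (tensm f g) h ∘ assoc X Y Z;
  pentagon : forall W X Y Z,
    assoc (tens W X) Y Z ∘ assoc W X (tens Y Z) =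
    tensm (assoc W X Y) (idm Z) ∘ assoc W (tens X Y) Z
      ∘ tensm (idm W) (assoc X Y Z);
  triangle : forall X Y,
    tensm (runit X) (idm Y) ∘ assoc X unit_ob Y = tensm (idm X) (lunit Y) }.

Arguments unit_ob {k} m : rename.
Arguments lunit {k m} X : rename.
Arguments runit {k m} X : rename.
Arguments assoc {k m} X Y Z : rename.
Notation "X ⊗ Y" := (tens X Y) : cat_scope.
Notation "f [⊗] g" := (tensm f g) : cat_scope.

Record brMonCat (k : fieldType) := BrMonCat {
  br_mon :> monCat k;
  braid : forall X Y : br_mon, iso (X ⊗ Y) (Y ⊗ X);
  braid_nat : forall (X X' Y Y' : br_mon) (f : Mor X X') (g : Mor Y Y'),
    braid X' Y' ∘ (f [⊗] g) = (g [⊗] f) ∘ braid X Y;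
  hexagonl : forall X Y Z : br_mon,
    assoc Z X Y ∘ braid (X ⊗ Y) Z ∘ assoc X Y Z =
    (braid X Z [⊗] idm Y) ∘ assoc X Z Y ∘ (idm X [⊗] braid Y Z);
  hexagonr : forall X Y Z : br_mon,
    (assoc Y Z X)⁻¹ ∘ braid X (Y ⊗ Z) ∘ (assoc X Y Z)⁻¹ =
    (idm Y [⊗] braid X Z) ∘ (assoc Y X Z)⁻¹ ∘ (braid X Y [⊗] idm Z) }.

Arguments braid {k b} X Y : rename.

Record tensorCat (k : fieldType) := TensorCat {
  tc_mon :> monCat k;
  tc_abelian : abelianCat tc_mon }.

Record braidedTensorCat (k : fieldType) := BraidedTensorCat {
  btc_mon :> brMonCat k;
  btc_abelian : abelianCat btc_mon }.


(* Abelianness is not part of the notion of tensor functor; it is not required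
   here because the center of an abelian tensor category need not be abelian
   when the tensor product is not exact. *)
Record tensorFunctor (k : fieldType) (C D : monCat k) := TensorFunctor {
  tf_ob :> C -> D;
  tf_mor : forall X Y : C, Mor X Y -> Mor (tf_ob X) (tf_ob Y);
  tf_id : forall X : C, tf_mor (idm X) = idm (tf_ob X);
  tf_comp : forall (X Y Z : C) (g : Mor Y Z) (f : Mor X Y),
    tf_mor (g ∘ f) = tf_mor g ∘ tf_mor f;
  tf_lin : forall X Y : C, linear (@tf_mor X Y);
  tf_mult : forall X Y : C, iso (tf_ob (X ⊗ Y)) (tf_ob X ⊗ tf_ob Y);
  tf_unit : iso (tf_ob (unit_ob C)) (unit_ob D);
  tf_mult_nat : forall (X X' Y Y' : C) (f : Mor X X') (g : Mor Y Y'),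
    tf_mult X' Y' ∘ tf_mor (f [⊗] g) = (tf_mor f [⊗] tf_mor g) ∘ tf_mult X Y;
  tf_assoc : forall X Y Z : C,
    (tf_mult X Y [⊗] idm (tf_ob Z)) ∘ tf_mult (X ⊗ Y) Z ∘ tf_mor (assoc X Y Z) =
    assoc (tf_ob X) (tf_ob Y) (tf_ob Z)
      ∘ (idm (tf_ob X) [⊗] tf_mult Y Z) ∘ tf_mult X (Y ⊗ Z);
  tf_lunit : forall X : C,
    lunit (tf_ob X) ∘ (tf_unit [⊗] idm (tf_ob X)) ∘ tf_mult (unit_ob C) X =
    tf_mor (lunit X);
  tf_runit : forall X : C,
    runit (tf_ob X) ∘ (idm (tf_ob X) [⊗] tf_unit) ∘ tf_mult X (unit_ob C) =
    tf_mor (runit X) }.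

Arguments tf_unit {k C D} t : rename.

Definition braided (k : fieldType) (C D : brMonCat k) (T : tensorFunctor C D) :=
  forall X Y : C,
    braid (T X) (T Y) ∘ tf_mult T X Y = tf_mult T Y X ∘ tf_mor T (braid X Y).


Record moduleCat (k : fieldType) (C : monCat k) (M : linCat k) := ModuleCat {
  act : C -> M -> M;
  actm : forall (X X' : C) (N N' : M),
    Mor X X' -> Mor N N' -> Mor (act X N) (act X' N');
  act_id : forall (X : C) (N : M), actm (idm X) (idm N) = idm (act X N);
  act_comp : forall (X X' X'' : C) (N N' N'' : M)
    (f' : Mor X' X'') (f : Mor X X') (g' : Mor N' N'') (g : Mor N N'),
    actm (f' ∘ f) (g' ∘ g) = actm f' g' ∘ actm f g;
  act_linl : forall (X X' : C) (N N' : M) (g : Mor N N'),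
    linear (fun f : Mor X X' => actm f g);
  act_linr : forall (X X' : C) (N N' : M) (f : Mor X X'),
    linear (fun g : Mor N N' => actm f g);
  act_assoc : forall (X1 X2 : C) (N : M),
    iso (act X1 (act X2 N)) (act (X1 ⊗ X2) N);
  act_unit : forall N : M, iso (act (unit_ob C) N) N;
  act_assoc_nat : forall (X1 X1' X2 X2' : C) (N N' : M)
    (f1 : Mor X1 X1') (f2 : Mor X2 X2') (g : Mor N N'),
    act_assoc X1' X2' N' ∘ actm f1 (actm f2 g) =
    actm (f1 [⊗] f2) g ∘ act_assoc X1 X2 N;
  act_unit_nat : forall (N N' : M) (g : Mor N N'),
    act_unit N' ∘ actm (idm (unit_ob C)) g = g ∘ act_unit N;
  act_pentagon : forall (X1 X2 X3 : C) (N : M),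
    act_assoc (X1 ⊗ X2) X3 N ∘ act_assoc X1 X2 (act X3 N) =
    actm (assoc X1 X2 X3) (idm N) ∘ act_assoc X1 (X2 ⊗ X3) N
      ∘ actm (idm X1) (act_assoc X2 X3 N);
  act_triangle : forall (X : C) (N : M),
    actm (runit X) (idm N) ∘ act_assoc X (unit_ob C) N =
    actm (idm X) (act_unit N) }.

Arguments act {k C M} m X N : rename.
Arguments actm {k C M} m {X X' N N'} f g : rename.
Arguments act_assoc {k C M} m X1 X2 N : rename.
Arguments act_unit {k C M} m N : rename.

(* The action of [C] on a monoidal category [M], with associativity
   isomorphisms relating it to the tensor product of [M]. There is no triangle
   for [X], [unit_ob M], [N], since no isomorphism from [act X (unit_ob M)] to an
   object of [M] is given. *)
Record tensorModuleCat (k : fieldType) (C M : monCat k) := TensorModuleCat {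
  tm_mod :> moduleCat C M;
  tm_assoc : forall (X : C) (M1 M2 : M),
    iso (act tm_mod X (M1 ⊗ M2)) (act tm_mod X M1 ⊗ M2);
  tm_assoc_nat : forall (X X' : C) (M1 M1' M2 M2' : M)
    (f : Mor X X') (g1 : Mor M1 M1') (g2 : Mor M2 M2'),
    tm_assoc X' M1' M2' ∘ actm tm_mod f (g1 [⊗] g2) =
    (actm tm_mod f g1 [⊗] g2) ∘ tm_assoc X M1 M2;
  tm_pentagon_CCMM : forall (X1 X2 : C) (M1 M2 : M),
    tm_assoc (X1 ⊗ X2) M1 M2 ∘ act_assoc tm_mod X1 X2 (M1 ⊗ M2) =
    (act_assoc tm_mod X1 X2 M1 [⊗] idm M2) ∘ tm_assoc X1 (act tm_mod X2 M1) M2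
      ∘ actm tm_mod (idm X1) (tm_assoc X2 M1 M2);
  tm_pentagon_CMMM : forall (X : C) (M1 M2 M3 : M),
    assoc (act tm_mod X M1) M2 M3 ∘ tm_assoc X M1 (M2 ⊗ M3) =
    (tm_assoc X M1 M2 [⊗] idm M3) ∘ tm_assoc X (M1 ⊗ M2) M3
      ∘ actm tm_mod (idm X) (assoc M1 M2 M3);
  tm_triangle_l : forall M1 M2 : M,
    (act_unit tm_mod M1 [⊗] idm M2) ∘ tm_assoc (unit_ob C) M1 M2 =
    act_unit tm_mod (M1 ⊗ M2);
  tm_triangle_r : forall (X : C) (N : M),
    runit (act tm_mod X N) ∘ tm_assoc X N (unit_ob M) =
    actm tm_mod (idm X) (runit N) }.

Arguments tm_assoc {k C M} t X M1 M2 : rename.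


(* [mcompA] normalizes composites to the right; these lemmas rewrite with an
   equation inside a longer composite in that form. *)
Lemma compR {k : fieldType} {C : linCat k} {X Y Z : C}
    {g : Mor Y Z} {f : Mor X Y} {u : Mor X Z} :
  g ∘ f = u -> forall W (h : Mor W X), g ∘ f ∘ h = u ∘ h.
Proof. by move=> <- W h; rewrite mcompA. Qed.

Lemma compRR {k : fieldType} {C : linCat k} {X Y Y' Z : C}
    {g : Mor Y Z} {f : Mor X Y} {g' : Mor Y' Z} {f' : Mor X Y'} :
  g ∘ f = g' ∘ f' -> forall W (h : Mor W X), g ∘ f ∘ h = g' ∘ f' ∘ h.
Proof. by move=> E W h; rewrite -!mcompA E. Qed.

Lemma compR3 {k : fieldType} {C : linCat k} {V X Y Z : C}
    {g : Mor Y Z} {f : Mor X Y} {e : Mor V X} {u : Mor V Z} :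
  g ∘ f ∘ e = u -> forall W (h : Mor W V), g ∘ f ∘ e ∘ h = u ∘ h.
Proof. by move=> <- W h; rewrite !mcompA. Qed.

Definition iso_id {k : fieldType} {C : linCat k} (X : C) : iso X X :=
  Iso (mcomp1m (idm X)) (mcomp1m (idm X)).

Definition iso_sym {k : fieldType} {C : linCat k} {X Y : C} (f : iso X Y) :
  iso Y X := Iso (isoVK f) (isoK f).

Section IsoComp.
Context {k : fieldType} {C : linCat k} {X Y Z : C} (g : iso Y Z) (f : iso X Y).

Lemma iso_compK : (f⁻¹ ∘ g⁻¹) ∘ (g ∘ f) = idm X.
Proof. by rewrite mcompA (compR (isoK g)) mcomp1m isoK. Qed.

Lemma iso_compVK : (g ∘ f) ∘ (f⁻¹ ∘ g⁻¹) = idm Z.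
Proof. by rewrite mcompA (compR (isoVK f)) mcomp1m isoVK. Qed.

Definition iso_comp : iso X Z := Iso iso_compK iso_compVK.

End IsoComp.

Lemma iso_monic {k : fieldType} {C : linCat k} {X Y W : C} (i : iso X Y)
  (f g : Mor W X) : i ∘ f = i ∘ g -> f = g.
Proof.
by move=> E; rewrite -[f]mcomp1m -(isoK i) mcompA E -mcompA isoK mcomp1m.
Qed.

Lemma iso_epic {k : fieldType} {C : linCat k} {X Y W : C} (i : iso X Y)
  (f g : Mor Y W) : f ∘ i = g ∘ i -> f = g.
Proof.
by move=> E; rewrite -[f]mcompm1 -(isoVK i) -mcompA E mcompA isoVK mcompm1.
Qed.

Section IsoTens.
Context {k : fieldType} {C : monCat k} {X X' Y Y' : C}.
Variables (f : iso X X') (g : iso Y Y').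

Lemma iso_tensK : (f⁻¹ [⊗] g⁻¹) ∘ (f [⊗] g) = idm (X ⊗ Y).
Proof. by rewrite -tens_comp !isoK tens_id. Qed.

Lemma iso_tensVK : (f [⊗] g) ∘ (f⁻¹ [⊗] g⁻¹) = idm (X' ⊗ Y').
Proof. by rewrite -tens_comp !isoVK tens_id. Qed.

Definition iso_tens : iso (X ⊗ Y) (X' ⊗ Y') := Iso iso_tensK iso_tensVK.

End IsoTens.

Section IsoAct.
Context {k : fieldType} {C : monCat k} {M : linCat k} (a : moduleCat C M).
Context {X X' : C} {N N' : M}.
Variables (f : iso X X') (g : iso N N').

Lemma iso_actK : actm a (f⁻¹) (g⁻¹) ∘ actm a f g = idm (act a X N).
Proof. by rewrite -act_comp !isoK act_id. Qed.

Lemma iso_actVK : actm a f g ∘ actm a (f⁻¹) (g⁻¹) = idm (act a X' N').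
Proof. by rewrite -act_comp !isoVK act_id. Qed.

Definition iso_act : iso (act a X N) (act a X' N') := Iso iso_actK iso_actVK.

End IsoAct.

Section ModuleCoherence.
Context {k : fieldType} {C : monCat k} {M : linCat k} (a : moduleCat C M).

Lemma act_compr (X : C) (N N' N'' : M) (g : Mor N' N'') (f : Mor N N') :
  actm a (idm X) (g ∘ f) = actm a (idm X) g ∘ actm a (idm X) f.
Proof. by rewrite -act_comp mcomp1m. Qed.

Lemma act_unit_inj (N N' : M) (f g : Mor N N') :
  actm a (idm (unit_ob C)) f = actm a (idm (unit_ob C)) g -> f = g.
Proof.
by move=> E; apply: (iso_epic (i := act_unit a N)); rewrite -!act_unit_nat E.
Qed.

Lemma act_lunit (X : C) (N : M) :
  actm a (lunit X) (idm N) ∘ act_assoc a (unit_ob C) X N = act_unit a (act a X N).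
Proof.
apply: act_unit_inj; apply: (iso_monic (i := act_assoc a (unit_ob C) X N)).
rewrite act_compr (compR (act_assoc_nat a (idm _) (lunit X) (idm N))).
rewrite -(act_triangle a) -(act_id a) (compR (act_assoc_nat a _ _ _)).
rewrite -triangle -[X in actm a (_ ∘ _) X](mcomp1m (idm N)) act_comp !mcompA.
by rewrite -act_pentagon.
Qed.

End ModuleCoherence.

Definition regular_module {k : fieldType} (C : monCat k) : moduleCat C C :=
  @ModuleCat k C C (@tens k C) (@tensm k C) (@tens_id k C) (@tens_comp k C)
    (@tens_linl k C) (@tens_linr k C) (@assoc k C) (@lunit k C)
    (@assoc_nat k C) (@lunit_nat k C) (@pentagon k C) (@triangle k C).

Section MonoidalCoherence.
Context {k : fieldType} {C : monCat k}.
Implicit Types X Y Z N : C.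

Lemma tens_compr X Y Y' Y'' (g' : Mor Y' Y'') (g : Mor Y Y') :
  idm X [⊗] (g' ∘ g) = (idm X [⊗] g') ∘ (idm X [⊗] g).
Proof. by rewrite -tens_comp mcomp1m. Qed.

Lemma tens_compl X X' X'' Y (f' : Mor X' X'') (f : Mor X X') :
  (f' ∘ f) [⊗] idm Y = (f' [⊗] idm Y) ∘ (f [⊗] idm Y).
Proof. by rewrite -tens_comp mcomp1m. Qed.

Lemma tens_interl X X' Y Y' (f : Mor X X') (g : Mor Y Y') :
  f [⊗] g = (f [⊗] idm Y') ∘ (idm X [⊗] g).
Proof. by rewrite -tens_comp mcompm1 mcomp1m. Qed.

Lemma tens_interr X X' Y Y' (f : Mor X X') (g : Mor Y Y') :
  f [⊗] g = (idm X' [⊗] g) ∘ (f [⊗] idm Y).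
Proof. by rewrite -tens_comp mcompm1 mcomp1m. Qed.

Lemma tens_inter X X' Y Y' (f : Mor X X') (g : Mor Y Y') :
  (idm X' [⊗] g) ∘ (f [⊗] idm Y) = (f [⊗] idm Y') ∘ (idm X [⊗] g).
Proof. by rewrite -tens_interl -tens_interr. Qed.

Lemma tens_unit_injr X Y (f g : Mor X Y) :
  f [⊗] idm (unit_ob C) = g [⊗] idm (unit_ob C) -> f = g.
Proof.
by move=> E; apply: (iso_epic (i := runit X)); rewrite -!runit_nat E.
Qed.

Lemma lunit_tens X Y :
  (lunit X [⊗] idm Y) ∘ assoc (unit_ob C) X Y = lunit (X ⊗ Y).
Proof. exact: (act_lunit (regular_module C)). Qed.

Lemma runit_tens X Y :
  runit (X ⊗ Y) ∘ assoc X Y (unit_ob C) = idm X [⊗] runit Y.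
Proof.
apply: tens_unit_injr.
apply: (iso_epic (i := assoc X (Y ⊗ unit_ob C) (unit_ob C))).
apply: (iso_epic (i := iso_tens (iso_id X) (assoc Y (unit_ob C) (unit_ob C)))).
rewrite /= tens_compl !mcompA -pentagon (compR (triangle _ _)).
rewrite -(compRR (assoc_nat (idm X) (runit Y) (idm (unit_ob C)))).
by rewrite -tens_compr triangle assoc_nat tens_id.
Qed.

Lemma lunit_unit : lunit (unit_ob C) = runit (unit_ob C) :> Mor _ _.
Proof.
apply: tens_unit_injr; apply: (iso_epic (i := assoc _ _ _)).
rewrite lunit_tens triangle; apply: (iso_monic (i := lunit _)).
by rewrite lunit_nat.
Qed.

End MonoidalCoherence.


Section Induction.
Context {k : fieldType} {C M : monCat k} (a : tensorModuleCat C M).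
Let I := unit_ob M.

Definition ind_ob (X : C) : M := act a X I.
Definition ind_mor (X Y : C) (f : Mor X Y) : Mor (ind_ob X) (ind_ob Y) :=
  actm a f (idm I).

Lemma ind_id (X : C) : ind_mor (idm X) = idm (ind_ob X).
Proof. exact: act_id. Qed.

Lemma ind_comp (X Y Z : C) (g : Mor Y Z) (f : Mor X Y) :
  ind_mor (g ∘ f) = ind_mor g ∘ ind_mor f.
Proof. by rewrite /ind_mor -act_comp mcomp1m. Qed.

Lemma ind_lin (X Y : C) : linear (@ind_mor X Y).
Proof. exact: act_linl. Qed.

Lemma lunitV_nat (X Y : M) (f : Mor X Y) :
  (lunit Y)⁻¹ ∘ f = (idm I [⊗] f) ∘ (lunit X)⁻¹.
Proof.
apply: (iso_monic (i := lunit Y)); rewrite (compR (isoVK _)) mcomp1m.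
by rewrite (compR (lunit_nat f)) mcompA isoVK mcompm1.
Qed.

Lemma assoc_lunitV (X Y : M) :
  assoc I X Y ∘ (lunit (X ⊗ Y))⁻¹ = (lunit X)⁻¹ [⊗] idm Y.
Proof.
apply: (iso_monic (i := iso_tens (lunit X) (iso_id Y))) => /=.
by rewrite (compR (lunit_tens _ _)) isoVK -tens_comp isoVK mcomp1m tens_id.
Qed.

(* The unit isomorphism is determined by the multiplication [ind_mult] below
   and the unit axioms of a tensor functor. *)
Definition ind_unit : iso (ind_ob (unit_ob C)) I := act_unit a I.

(* The multiplication is kept abstract during the diagram chases. *)
Section Chases.
Variable J : forall X Y : C, iso (ind_ob (X ⊗ Y)) (ind_ob X ⊗ ind_ob Y).
Hypothesis JE : forall X Y : C, J X Y ∘ act_assoc a X Y I =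
  tm_assoc a X I (act a Y I) ∘ actm a (idm X) (lunit (act a Y I))⁻¹.

Lemma ind_J_nat (X X' Y Y' : C) (f : Mor X X') (g : Mor Y Y') :
  J X' Y' ∘ ind_mor (f [⊗] g) = (ind_mor f [⊗] ind_mor g) ∘ J X Y.
Proof.
apply: (iso_epic (i := act_assoc a X Y I)).
rewrite !mcompA JE -act_assoc_nat (compR (JE _ _)).
rewrite !mcompA -act_comp lunitV_nat mcomp1m -[f in LHS]mcompm1 act_comp.
rewrite (compR (tm_assoc_nat a f _ _)) !mcompA.
by rewrite /ind_mor.
Qed.

Lemma ind_J_assoc (X Y Z : C) :
  (J X Y [⊗] idm (ind_ob Z)) ∘ J (X ⊗ Y) Z ∘ ind_mor (assoc X Y Z) =
  assoc (ind_ob X) (ind_ob Y) (ind_ob Z)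
    ∘ (idm (ind_ob X) [⊗] J Y Z) ∘ J X (Y ⊗ Z).
Proof.
apply: (iso_epic (i := act_assoc a X (Y ⊗ Z) I)).
apply: (iso_epic (i := iso_act a (iso_id X) (act_assoc a Y Z I))).
rewrite !mcompA /= -act_pentagon.
rewrite (compRR (JE _ _)) -[in LHS](tens_id X Y).
rewrite -act_assoc_nat (compRR (tm_pentagon_CCMM a _ _ _ _)) !mcompA.
rewrite (compR (esym (tens_compl _ _ _))). rewrite JE tens_compl !mcompA.
rewrite -(compRR (tm_assoc_nat a _ _ _)) (compRR (JE _ _)).
rewrite -(act_id a X I) -(compRR (tm_assoc_nat a _ _ _)).
rewrite (compR (tm_pentagon_CMMM a _ _ _ _)) !mcompA -!act_compr.
rewrite -(compRR (lunitV_nat _)) JE (compR (assoc_lunitV _ _)).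
by rewrite /ind_ob.
Qed.


Lemma ind_J_lunit (X : C) :
  lunit (ind_ob X) ∘ (ind_unit [⊗] idm (ind_ob X)) ∘ J (unit_ob C) X =
  ind_mor (lunit X).
Proof.
apply: (iso_epic (i := act_assoc a (unit_ob C) X I)).
rewrite !mcompA JE act_lunit (compR (tm_triangle_l a _ _)).
by rewrite act_unit_nat (compR (isoVK _)) mcomp1m.
Qed.

Lemma ind_J_runit (X : C) :
  runit (ind_ob X) ∘ (idm (ind_ob X) [⊗] ind_unit) ∘ J X (unit_ob C) =
  ind_mor (runit X).
Proof.
apply: (iso_epic (i := act_assoc a X (unit_ob C) I)).
rewrite !mcompA JE act_triangle /ind_ob -(act_id a).
rewrite -(compRR (tm_assoc_nat a _ _ _)) (compR (tm_triangle_r a _ _)).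
rewrite -!act_comp !mcomp1m -lunit_unit (compRR (lunit_nat _)).
by rewrite isoVK mcompm1.
Qed.

End Chases.

Definition ind_mult (X1 X2 : C) : iso (ind_ob (X1 ⊗ X2)) (ind_ob X1 ⊗ ind_ob X2) :=
  iso_comp (tm_assoc a X1 I (act a X2 I))
    (iso_comp (iso_act a (iso_id X1) (iso_sym (lunit (act a X2 I))))
       (iso_sym (act_assoc a X1 X2 I))).

Lemma ind_multE (X1 X2 : C) :
  ind_mult X1 X2 = tm_assoc a X1 I (act a X2 I)
    ∘ actm a (idm X1) (lunit (act a X2 I))⁻¹ ∘ (act_assoc a X1 X2 I)⁻¹ :> Mor _ _.
Proof. by []. Qed.

Lemma ind_mult_assoc (X1 X2 : C) :
  ind_mult X1 X2 ∘ act_assoc a X1 X2 I =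
  tm_assoc a X1 I (act a X2 I) ∘ actm a (idm X1) (lunit (act a X2 I))⁻¹.
Proof. by rewrite ind_multE !mcompA isoK mcompm1. Qed.

Definition induction_functor : tensorFunctor C M :=
  @TensorFunctor k C M ind_ob ind_mor ind_id ind_comp ind_lin ind_mult ind_unit
    (ind_J_nat ind_mult_assoc) (ind_J_assoc ind_mult_assoc)
    (ind_J_lunit ind_mult_assoc) (ind_J_runit ind_mult_assoc).

End Induction.


Section Pentagons.
Context {k : fieldType} {C : monCat k}.
Implicit Types W X Y Z : C.

Lemma assocV_nat X X' Y Y' Z Z' (f : Mor X X') (g : Mor Y Y') (h : Mor Z Z') :
  (assoc X' Y' Z')⁻¹ ∘ ((f [⊗] g) [⊗] h) =
  (f [⊗] (g [⊗] h)) ∘ (assoc X Y Z)⁻¹.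
Proof.
apply: (iso_monic (i := assoc X' Y' Z')); rewrite (compR (isoVK _)) mcomp1m.
by rewrite (compR (assoc_nat f g h)) mcompA isoVK mcompm1.
Qed.

Lemma pentagonV W X Y Z :
  (idm W [⊗] (assoc X Y Z)⁻¹) ∘ (assoc W (X ⊗ Y) Z)⁻¹
    ∘ ((assoc W X Y)⁻¹ [⊗] idm Z) =
  (assoc W X (Y ⊗ Z))⁻¹ ∘ (assoc (W ⊗ X) Y Z)⁻¹.
Proof.
apply: (iso_epic (i := iso_comp (assoc (W ⊗ X) Y Z) (assoc W X (Y ⊗ Z)))).
rewrite /= !mcompA (compR (isoK _)) mcomp1m isoK pentagon.
rewrite (compR (esym (tens_comp _ _ _ _))) isoK mcomp1m tens_id mcomp1m.
by rewrite (compR (isoK _)) mcomp1m -tens_comp isoK mcomp1m tens_id.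
Qed.

Lemma pentagonL W X Y Z :
  ((assoc W X Y)⁻¹ [⊗] idm Z) ∘ assoc (W ⊗ X) Y Z ∘ assoc W X (Y ⊗ Z) =
  assoc W (X ⊗ Y) Z ∘ (idm W [⊗] assoc X Y Z).
Proof.
rewrite pentagon (compR (esym (tens_comp _ _ _ _))) isoK mcomp1m tens_id.
by rewrite mcomp1m.
Qed.

Lemma pentagonR W X Y Z :
  (assoc (W ⊗ X) Y Z)⁻¹ ∘ (assoc W X Y [⊗] idm Z) ∘ assoc W (X ⊗ Y) Z =
  assoc W X (Y ⊗ Z) ∘ (idm W [⊗] (assoc X Y Z)⁻¹).
Proof.
apply: (iso_epic (i := iso_tens (iso_id W) (assoc X Y Z))).
rewrite /= !mcompA -pentagon (compR (isoK _)) mcomp1m -tens_comp isoK mcomp1m.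
by rewrite tens_id mcompm1.
Qed.

Lemma pentagonL' W X Y Z :
  ((assoc W X Y)⁻¹ [⊗] idm Z) ∘ assoc (W ⊗ X) Y Z =
  assoc W (X ⊗ Y) Z ∘ (idm W [⊗] assoc X Y Z) ∘ (assoc W X (Y ⊗ Z))⁻¹.
Proof.
apply: (iso_epic (i := assoc W X (Y ⊗ Z))).
by rewrite !mcompA isoK mcompm1 pentagonL.
Qed.

Lemma lunit_tensV X Y :
  lunit (X ⊗ Y) ∘ (assoc (unit_ob C) X Y)⁻¹ = lunit X [⊗] idm Y.
Proof. by rewrite -lunit_tens !mcompA isoVK mcompm1. Qed.

Lemma runit_tensV X Y :
  (idm X [⊗] runit Y) ∘ (assoc X Y (unit_ob C))⁻¹ = runit (X ⊗ Y).
Proof. by rewrite -runit_tens !mcompA isoVK mcompm1. Qed.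

End Pentagons.

Record centerOb (k : fieldType) (M : monCat k) := CenterOb {
  z_ob :> M;
  z_hb : forall N : M, iso (N ⊗ z_ob) (z_ob ⊗ N);
  z_nat : forall (N N' : M) (f : Mor N N'),
    z_hb N' ∘ (f [⊗] idm z_ob) = (idm z_ob [⊗] f) ∘ z_hb N;
  z_hex : forall Y Z : M,
    assoc z_ob Y Z ∘ z_hb (Y ⊗ Z) ∘ assoc Y Z z_ob =
    (z_hb Y [⊗] idm Z) ∘ assoc Y z_ob Z ∘ (idm Y [⊗] z_hb Z) }.

Lemma z_hexE {k : fieldType} {M : monCat k} (X : centerOb M) (P Q : M) :
  z_hb X (P ⊗ Q) = (assoc (z_ob X) P Q)⁻¹ ∘ (z_hb X P [⊗] idm Q)
    ∘ assoc P (z_ob X) Q ∘ (idm P [⊗] z_hb X Q) ∘ (assoc P Q (z_ob X))⁻¹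
  :> Mor _ _.
Proof.
apply: (iso_epic (i := assoc P Q (z_ob X))).
apply: (iso_monic (i := assoc (z_ob X) P Q)).
by rewrite !mcompA z_hex isoK mcompm1 (compR (isoVK _)) mcomp1m.
Qed.

Lemma linear_eq0 {k : fieldType} {U V : lmodType k} {f : U -> V} :
  linear f -> f 0 = 0.
Proof.
by move=> Hf; have := Hf (-1) 0 0; rewrite scaler0 addr0 scaleN1r addNr.
Qed.

Section CenterHom.
Context {k : fieldType} {M : monCat k} (X Y : centerOb M).

Definition is_center_mor (f : Mor (z_ob X) (z_ob Y)) :=
  forall N : M, z_hb Y N ∘ (idm N [⊗] f) = (f [⊗] idm N) ∘ z_hb X N.

Definition center_mor : {pred Mor (z_ob X) (z_ob Y)} :=
  fun f => `[< is_center_mor f >].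

Lemma center_mor_submod : submod_closed center_mor.
Proof.
split=> [|c f g /asboolP Hf /asboolP Hg]; apply/asboolP => N.
  by rewrite (linear_eq0 (tens_linr _)) (linear_eq0 (tens_linl _))
    (linear_eq0 (mcomp_linl _)) (linear_eq0 (mcomp_linr _)).
by rewrite (tens_linr (idm N)) mcomp_linr Hf Hg tens_linl mcomp_linl.
Qed.

HB.instance Definition _ :=
  GRing.isSubmodClosed.Build k (Mor (z_ob X) (z_ob Y)) center_mor
    (GRing.submod_closed_semi center_mor_submod).

Record centerHom := CenterHom {
  zh_mor :> Mor (z_ob X) (z_ob Y);
  zh_in : zh_mor \in center_mor }.

HB.instance Definition _ := [isSub for zh_mor].
HB.instance Definition _ := [Choice of centerHom by <:].
HB.instance Definition _ := [SubChoice_isSubLmodule of centerHom by <:].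

End CenterHom.

Lemma centerHomE {k : fieldType} {M : monCat k} {X Y : centerOb M}
  (f : centerHom X Y) : is_center_mor (zh_mor f).
Proof. exact/asboolP/zh_in. Qed.

Definition mkCenterHom {k : fieldType} {M : monCat k} {X Y : centerOb M}
    (f : Mor (z_ob X) (z_ob Y)) (Hf : is_center_mor f) : centerHom X Y :=
  @CenterHom k M X Y f (asboolT Hf).

Section CenterCat.
Context {k : fieldType} {M : monCat k}.
Implicit Types X Y Z : centerOb M.

Lemma center_id_mor X : is_center_mor (X := X) (Y := X) (idm X).
Proof. by move=> N; rewrite !tens_id mcompm1 mcomp1m. Qed.

Lemma center_comp_mor X Y Z (g : centerHom Y Z) (f : centerHom X Y) :
  is_center_mor (X := X) (Y := Z) (zh_mor g ∘ zh_mor f).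
Proof.
move=> N; rewrite tens_compr (compRR (centerHomE g N)) (centerHomE f N).
by rewrite -mcompA -tens_compl.
Qed.

Definition center_id X := mkCenterHom (center_id_mor X).
Definition center_comp X Y Z (g : centerHom Y Z) (f : centerHom X Y) :=
  mkCenterHom (center_comp_mor g f).

Lemma center_comp1m X Y (f : centerHom X Y) : center_comp (center_id Y) f = f.
Proof. by apply: val_inj; exact: mcomp1m. Qed.

Lemma center_compm1 X Y (f : centerHom X Y) : center_comp f (center_id X) = f.
Proof. by apply: val_inj; exact: mcompm1. Qed.

Lemma center_compA (W X Y Z : centerOb M)
    (h : centerHom Y Z) (g : centerHom X Y) (f : centerHom W X) :
  center_comp (center_comp h g) f = center_comp h (center_comp g f).
Proof. by apply: val_inj; exact: mcompA. Qed.

Lemma center_comp_linl X Y Z (f : centerHom X Y) :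
  linear (fun g : centerHom Y Z => center_comp g f).
Proof. by move=> c g h; apply: val_inj; exact: mcomp_linl. Qed.

Lemma center_comp_linr X Y Z (g : centerHom Y Z) :
  linear (fun f : centerHom X Y => center_comp g f).
Proof. by move=> c f h; apply: val_inj; exact: mcomp_linr. Qed.

Definition center_lin : linCat k :=
  @LinCat k (centerOb M) (fun X Y => centerHom X Y) center_id center_comp
    center_comp1m center_compm1 center_compA center_comp_linl center_comp_linr.

(* An isomorphism of [M] that is a morphism in the center is an isomorphism
   in the center. *)
Section CenterIso.
Variables (X Y : centerOb M) (f : iso (z_ob X) (z_ob Y)).
Hypothesis Hf : is_center_mor (X := X) (Y := Y) f.

Lemma center_inv_mor : is_center_mor (X := Y) (Y := X) f⁻¹.
Proof.
move=> N; apply: (iso_monic (i := iso_tens f (iso_id N))) => /=.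
rewrite -(compRR (Hf N)) -tens_compr isoVK tens_id mcompm1.
by rewrite (compR (esym (tens_compl _ _ _))) isoVK tens_id mcomp1m.
Qed.

Lemma center_isoK :
  @mcomp k center_lin X Y X (mkCenterHom center_inv_mor) (mkCenterHom Hf) =
  @idm k center_lin X.
Proof. by apply: val_inj; exact: isoK. Qed.

Lemma center_isoVK :
  @mcomp k center_lin Y X Y (mkCenterHom Hf) (mkCenterHom center_inv_mor) =
  @idm k center_lin Y.
Proof. by apply: val_inj; exact: isoVK. Qed.

Definition center_iso : @iso k center_lin X Y := @Iso k center_lin X Y _ _ center_isoK center_isoVK.

End CenterIso.

Section CenterTensor.
Variables X Y : centerOb M.

Definition center_tens_hb (N : M) : iso (N ⊗ (X ⊗ Y)) ((X ⊗ Y) ⊗ N) :=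
  iso_comp (assoc X Y N) (iso_comp (iso_tens (iso_id (z_ob X)) (z_hb Y N))
    (iso_comp (iso_sym (assoc X N Y))
      (iso_comp (iso_tens (z_hb X N) (iso_id (z_ob Y))) (assoc N X Y)))).

Lemma center_tens_hbE (N : M) : center_tens_hb N =
  assoc X Y N ∘ (idm (z_ob X) [⊗] z_hb Y N) ∘ (assoc X N Y)⁻¹
    ∘ (z_hb X N [⊗] idm (z_ob Y)) ∘ assoc N X Y :> Mor _ _.
Proof. by []. Qed.

Lemma center_tens_nat (N N' : M) (f : Mor N N') :
  center_tens_hb N' ∘ (f [⊗] idm (X ⊗ Y)) =
  (idm (X ⊗ Y) [⊗] f) ∘ center_tens_hb N.
Proof.
rewrite !center_tens_hbE -!tens_id !mcompA assoc_nat.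
rewrite (compR (esym (tens_compl _ _ _))) z_nat tens_compl !mcompA.
rewrite (compRR (assocV_nat _ _ _)) (compR (esym (tens_compr _ _ _))) z_nat.
by rewrite tens_compr !mcompA (compRR (assoc_nat _ _ _)).
Qed.

Lemma center_tens_hex (P Q : M) :
  assoc (X ⊗ Y) P Q ∘ center_tens_hb (P ⊗ Q) ∘ assoc P Q (X ⊗ Y) =
  (center_tens_hb P [⊗] idm Q) ∘ assoc P (X ⊗ Y) Q
    ∘ (idm P [⊗] center_tens_hb Q).
Proof.
rewrite !center_tens_hbE !tens_compr !tens_compl !mcompA.
rewrite (compR (pentagon X Y P Q)) (pentagon P Q X Y) (z_hexE Y) (z_hexE X).
rewrite !tens_compr !tens_compl !mcompA.
rewrite (compR (esym (tens_compr _ (assoc Y P Q) _))) isoVK tens_id mcomp1m.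
rewrite (compR (esym (tens_compl _ _ (assoc P Q X)))) isoK tens_id mcomp1m.
rewrite (compRR (assoc_nat (idm (z_ob X)) (z_hb Y P) (idm Q))).
rewrite -(compRR (assoc_nat (idm P) (z_hb X Q) (idm (z_ob Y)))).
rewrite (compR3 (pentagonV X P Q Y)) !mcompA.
rewrite (compRR (assocV_nat (z_hb X P) (idm Q) (idm (z_ob Y)))).
rewrite (compR3 (pentagonR P X Q Y)) !mcompA.
rewrite -(compRR (assocV_nat (idm (z_ob X)) (idm P) (z_hb Y Q))) !tens_id.
rewrite (compRR (tens_inter _ _)) -(tens_id P (z_ob X)).
rewrite -(compRR (assoc_nat (idm P) (idm (z_ob X)) (z_hb Y Q))).
rewrite (compR3 (esym (pentagon P X Y Q))) !mcompA.
rewrite -(compRR (assoc_nat (z_hb X P) (idm (z_ob Y)) (idm Q))).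
by rewrite (compR (pentagonL' X P Y Q)) !mcompA tens_id.
Qed.

Definition center_tens : centerOb M :=
  CenterOb center_tens_nat center_tens_hex.

End CenterTensor.

Section CenterTensorMor.
Variables (X X' Y Y' : centerOb M) (f : centerHom X X') (g : centerHom Y Y').

Lemma center_tensm_mor :
  is_center_mor (X := center_tens X Y) (Y := center_tens X' Y')
    (zh_mor f [⊗] zh_mor g).
Proof.
move=> N; rewrite !center_tens_hbE !mcompA assoc_nat.
rewrite (compR (esym (tens_comp _ _ _ _))) mcomp1m (centerHomE f N).
rewrite -[zh_mor g in LHS]mcompm1 tens_comp !mcompA.
rewrite (compRR (assocV_nat _ _ _)) (compR (esym (tens_comp _ _ _ _))) mcomp1m.
rewrite (centerHomE g N) -[zh_mor f in LHS]mcompm1 tens_comp !mcompA.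
by rewrite (compRR (assoc_nat _ _ _)).
Qed.

Definition center_tensm : centerHom (center_tens X Y) (center_tens X' Y') :=
  mkCenterHom center_tensm_mor.

End CenterTensorMor.

Definition center_unit_hb (N : M) : iso (N ⊗ unit_ob M) (unit_ob M ⊗ N) :=
  iso_comp (iso_sym (lunit N)) (runit N).

Lemma center_unit_nat (N N' : M) (f : Mor N N') :
  center_unit_hb N' ∘ (f [⊗] idm (unit_ob M)) =
  (idm (unit_ob M) [⊗] f) ∘ center_unit_hb N.
Proof.
by rewrite /= !mcompA runit_nat (compRR (lunitV_nat _)).
Qed.

Lemma center_unit_hex (P Q : M) :
  assoc (unit_ob M) P Q ∘ center_unit_hb (P ⊗ Q) ∘ assoc P Q (unit_ob M) =
  (center_unit_hb P [⊗] idm Q) ∘ assoc P (unit_ob M) Q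
    ∘ (idm P [⊗] center_unit_hb Q).
Proof.
rewrite /= tens_compr tens_compl !mcompA runit_tens (compR (assoc_lunitV _ _)).
rewrite (compR (triangle _ _)) (compR (esym (tens_compr _ _ _))) isoVK.
by rewrite tens_id mcomp1m.
Qed.

Definition center_unit : centerOb M := CenterOb center_unit_nat center_unit_hex.

Lemma center_lunit_mor X :
  is_center_mor (X := center_tens center_unit X) (Y := X) (lunit X).
Proof.
move=> N; rewrite /= ?mcompA (compR (lunit_tens _ _)) (compRR (lunit_nat _)).
rewrite (compR (lunit_tensV _ _)) (compR (esym (tens_compl _ _ _))).
by rewrite (compR (isoVK _)) mcomp1m triangle.
Qed.

Lemma center_runit_mor X :
  is_center_mor (X := center_tens X center_unit) (Y := X) (runit X).
Proof.
move=> N; rewrite /= ?mcompA (compR (triangle _ _)).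
rewrite (compR (esym (tens_compr _ _ _))) (compR (isoVK _)) mcomp1m.
by rewrite (compR (runit_tensV _ _)) (compRR (runit_nat _)) runit_tens.
Qed.

Lemma center_assoc_mor X Y Z :
  is_center_mor (X := center_tens X (center_tens Y Z))
    (Y := center_tens (center_tens X Y) Z) (assoc X Y Z).
Proof.
move=> N; rewrite /= !tens_compr !tens_compl ?mcompA -pentagon.
rewrite (compR3 (esym (pentagon X Y Z N))) !mcompA.
rewrite -(compRR (assoc_nat (z_hb X N) (idm (z_ob Y)) (idm (z_ob Z)))).
rewrite (compR (pentagonL' X N Y Z)) !mcompA.
rewrite -(compRR (assoc_nat (idm (z_ob X)) (z_hb Y N) (idm (z_ob Z)))).
rewrite (compR3 (pentagonR X Y N Z)) !mcompA -(tens_id X Y).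
by rewrite -(compRR (assoc_nat _ _ _)) tens_id.
Qed.

Lemma center_braid_mor X Y :
  is_center_mor (X := center_tens X Y) (Y := center_tens Y X) (z_hb Y X).
Proof.
move=> N; rewrite /= ?mcompA -z_hex (compR (isoK _)) mcomp1m.
rewrite -(compRR (z_nat Y (z_hb X N))) (compR3 (esym (z_hex _ _ _))) !mcompA.
by rewrite (compR (isoVK _)) mcomp1m.
Qed.

Definition center_mon : monCat k.
Proof.
refine (@MonCat k center_lin center_tens (@center_tensm) _ _ _ _ center_unit
  (fun X => center_iso (center_lunit_mor X))
  (fun X => center_iso (center_runit_mor X))
  (fun X Y Z => center_iso (center_assoc_mor X Y Z)) _ _ _ _ _) => /=.
- by move=> X Y; apply: val_inj; exact: tens_id.
- by move=> *; apply: val_inj; exact: tens_comp.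
- by move=> X X' Y Y' g c f f'; apply: val_inj; exact: tens_linl.
- by move=> X X' Y Y' f c g g'; apply: val_inj; exact: tens_linr.
- by move=> X Y f; apply: val_inj; exact: lunit_nat.
- by move=> X Y f; apply: val_inj; exact: runit_nat.
- by move=> *; apply: val_inj; exact: assoc_nat.
- by move=> W X Y Z; apply: val_inj; exact: pentagon.
- by move=> X Y; apply: val_inj; exact: triangle.
Defined.

Definition center : brMonCat k.
Proof.
refine (@BrMonCat k center_mon (fun X Y => center_iso (center_braid_mor X Y))
  _ _ _).
- move=> X X' Y Y' f g; apply: val_inj.
  rewrite /= tens_interr (compR (centerHomE g _)) mcompA z_nat -mcompA.
  by rewrite -tens_interl.
- by move=> X Y Z; apply: val_inj; exact: z_hex.
- move=> X Y Z; apply: val_inj.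
  rewrite /= ?mcompA (compR (isoK _)) mcomp1m isoVK mcompm1.
  by [].
Defined.

Definition center_forget : tensorFunctor center M.
Proof.
refine (@TensorFunctor k center M (@z_ob k M)
  (fun X Y => @zh_mor k M X Y) _ _ _
  (fun X Y => iso_id (z_ob X ⊗ z_ob Y)) (iso_id (unit_ob M)) _ _ _ _) => /=.
- by [].
- by [].
- by [].
- by move=> *; rewrite mcomp1m mcompm1.
- by move=> *; rewrite !tens_id !mcomp1m !mcompm1.
- by move=> *; rewrite tens_id !mcompm1.
- by move=> *; rewrite tens_id !mcompm1.
Defined.

End CenterCat.

Arguments center {k} M.
Arguments center_forget {k} M.

Section TensorFunctorComp.
Context {k : fieldType} {C D E : monCat k}.
Variables (S : tensorFunctor D E) (T : tensorFunctor C D).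

Lemma tf_isoK (X Y : D) (f : iso X Y) :
  tf_mor S f⁻¹ ∘ tf_mor S f = idm (S X).
Proof. by rewrite -tf_comp isoK tf_id. Qed.

Lemma tf_isoVK (X Y : D) (f : iso X Y) :
  tf_mor S f ∘ tf_mor S f⁻¹ = idm (S Y).
Proof. by rewrite -tf_comp isoVK tf_id. Qed.

Definition tf_iso (X Y : D) (f : iso X Y) : iso (S X) (S Y) :=
  Iso (tf_isoK f) (tf_isoVK f).

Lemma tf_mult_natl (X X' Y : D) (f : Mor X X') :
  (tf_mor S f [⊗] idm (S Y)) ∘ tf_mult S X Y =
  tf_mult S X' Y ∘ tf_mor S (f [⊗] idm Y).
Proof. by rewrite tf_mult_nat tf_id. Qed.

Lemma tf_mult_natr (X Y Y' : D) (f : Mor Y Y') :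
  (idm (S X) [⊗] tf_mor S f) ∘ tf_mult S X Y =
  tf_mult S X Y' ∘ tf_mor S (idm X [⊗] f).
Proof. by rewrite tf_mult_nat tf_id. Qed.

Definition tensorFunctor_comp : tensorFunctor C E.
Proof.
refine (@TensorFunctor k C E (fun X => S (T X))
  (fun X Y f => tf_mor S (tf_mor T f)) _ _ _
  (fun X Y => iso_comp (tf_mult S (T X) (T Y)) (tf_iso (tf_mult T X Y)))
  (iso_comp (tf_unit S) (tf_iso (tf_unit T))) _ _ _ _) => /=.
- by move=> X; rewrite !tf_id.
- by move=> X Y Z g f; rewrite !tf_comp.
- by move=> X Y c f g; rewrite !tf_lin.
- move=> X X' Y Y' f g; rewrite !mcompA -tf_comp tf_mult_nat tf_comp.
  by rewrite (compRR (tf_mult_nat S _ _)).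
- move=> X Y Z; rewrite tens_compl tens_compr !mcompA (compRR (tf_mult_natl _ _)).
  rewrite -!tf_comp tf_assoc !tf_comp (compR3 (tf_assoc S _ _ _)) !mcompA.
  by rewrite (compRR (tf_mult_natr _ _)).
- move=> X; rewrite tens_compl !mcompA (compRR (tf_mult_natl _ _)).
  by rewrite (compR3 (tf_lunit S _)) -!tf_comp tf_lunit.
- move=> X; rewrite tens_compr !mcompA (compRR (tf_mult_natr _ _)).
  by rewrite (compR3 (tf_runit S _)) -!tf_comp tf_runit.
Defined.

End TensorFunctorComp.


(* The equality of tensor functors is Leibniz equality: it identifies objects,
   morphisms and structure isomorphisms on the nose. *)
Definition central (k : fieldType) (C : brMonCat k) (M : monCat k)
    (T : tensorFunctor C M) :=
  exists G : tensorFunctor C (center M),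
    braided G /\ T = tensorFunctor_comp (center_forget M) G.

(* Linearity of [ihom_lam] need not be required: naturality forces
   [ihom_inv X f] to be [ihom_ev ∘ actm a f id], which is linear in [f]. *)
Record internalHom (k : fieldType) (C : monCat k) (M : linCat k)
    (a : moduleCat C M) (N N' : M) := InternalHom {
  ihom_ob :> C;
  ihom_lam : forall X : C, Mor (act a X N) N' -> Mor X ihom_ob;
  ihom_inv : forall X : C, Mor X ihom_ob -> Mor (act a X N) N';
  ihom_lamK : forall X : C, cancel (@ihom_lam X) (@ihom_inv X);
  ihom_invK : forall X : C, cancel (@ihom_inv X) (@ihom_lam X);
  ihom_nat : forall (X Y : C) (f : Mor X Y) (g : Mor (act a Y N) N'),
    ihom_lam (g ∘ actm a f (idm N)) = ihom_lam g ∘ f }.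

Definition ihom_ev (k : fieldType) (C : monCat k) (M : linCat k)
    (a : moduleCat C M) (N N' : M) (A : internalHom a N N') :
    Mor (act a A N) N' :=
  ihom_inv (idm (ihom_ob A)).

Definition ihom_mult (k : fieldType) (C : monCat k) (M : linCat k)
    (a : moduleCat C M) (N : M) (A : internalHom a N N) : Mor (A ⊗ A) A :=
  ihom_lam A (ihom_ev A ∘ actm a (idm (ihom_ob A)) (ihom_ev A)
    ∘ (act_assoc a A A N)⁻¹).

(* Main.v *)
(** Let [e : A ⊗ 1 -> 1] be the evaluation and [J] the multiplication of the
    induction functor [F]. The morphism [F (A ⊗ A) -> 1] representing [m] is
    [r ∘ (e ⊗ e) ∘ J]. Precomposing it with [F R] amounts, because [F] lifts to
    a braided functor into the center, to inserting the half-braiding between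
    [e ⊗ e] and [J]; by naturality this half-braiding can be moved to the unit
    object, where it is [r⁻¹ ∘ l] and disappears. *)
Require Import Defs.
From mathcomp Require Import all_boot all_algebra.
Local Open Scope cat_scope.

Lemma tens_unit_injl {k : fieldType} {C : monCat k} {X Y : C} {f g : Mor X Y} :
  idm (unit_ob C) [⊗] f = idm (unit_ob C) [⊗] g -> f = g.
Proof. exact: (act_unit_inj (a := regular_module C)). Qed.

(** The hexagon at two unit objects, followed by right unit maps, gives [(r ∘ g) ∘ (idm _ [⊗] lunit
    _) = (r ∘ g) ∘ (idm _ [⊗] (r ∘ g))]. Cancel the isomorphism [r ∘ g], then the faithful tensoring
    with the unit. *)
Lemma runit_half_braiding {k : fieldType} {M : monCat k} (X : centerOb M) :
  runit (z_ob X) ∘ z_hb X (unit_ob M) = lunit (z_ob X).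
Proof.
set r := runit _; set g := z_hb _ _.
apply: tens_unit_injl; apply: (iso_monic (i := iso_comp r g)) => /=.
have := congr1 (fun h => r ∘ (r [⊗] idm (unit_ob M)) ∘ h)
  (z_hex X (unit_ob M) (unit_ob M)).
rewrite !mcompA (compR (triangle _ _)) -(compRR (z_nat X (lunit (unit_ob M)))).
rewrite lunit_unit triangle (compR (esym (tens_compl _ _ _))).
rewrite (compRR (runit_nat (r ∘ g))) (compR (runit_tens _ _)).
by rewrite -tens_compr !mcompA.
Qed.

Lemma half_braiding_to_unit {k : fieldType} {M : monCat k} (X : centerOb M)
    {N : M} (e : Mor (z_ob X) (unit_ob M)) (f : Mor N (unit_ob M)) :
  runit (unit_ob M) ∘ (e [⊗] f) ∘ z_hb X N = runit (unit_ob M) ∘ (f [⊗] e).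
Proof.
rewrite tens_interl mcompA -(z_nat X f) (compRR (runit_nat e)).
rewrite (compR (runit_half_braiding X)) -(compRR (lunit_nat e)) lunit_unit.
by rewrite -tens_interr.
Qed.

Lemma central_braid {k : fieldType} {C : brMonCat k} {M : monCat k}
    (T : tensorFunctor C M) {X Y : C}
    (e : Mor (T X) (unit_ob M)) (f : Mor (T Y) (unit_ob M)) :
  central T ->
  runit (unit_ob M) ∘ (f [⊗] e) ∘ tf_mult T Y X ∘ tf_mor T (braid X Y) =
  runit (unit_ob M) ∘ (e [⊗] f) ∘ tf_mult T X Y.
Proof.
case=> G [bG eT]; case: _ / (esym eT) e f => /= e f.
(* In the center, the braiding of [G X] with [G Y] is the half-braiding of [G Y] at [G X]. *)
have /= bGXY := congr1 (fun h => zh_mor h) (bG X Y).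
rewrite !mcomp1m -bGXY.
by have /compR3 -> := half_braiding_to_unit (G Y) f e; rewrite mcompA.
Qed.

(** Since [l = r] on the unit object, the right unit cancels the [l⁻¹] inside [ind_mult]. *)
Lemma ind_mult_unit {k : fieldType} {C M : monCat k} (a : tensorModuleCat C M)
    {X Y : C} (e : Mor (ind_ob a X) (unit_ob M))
    (f : Mor (ind_ob a Y) (unit_ob M)) :
  runit (unit_ob M) ∘ (e [⊗] f) ∘ ind_mult a X Y =
  e ∘ actm a (idm X) f ∘ (act_assoc a X Y (unit_ob M))⁻¹.
Proof.
rewrite ind_multE tens_interl mcompA (compRR (runit_nat e)) -(act_id a X).
rewrite -(compRR (tm_assoc_nat a _ _ _)) (compR (tm_triangle_r a _ _)).
rewrite (compR (esym (act_compr _ _ _ _))).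
rewrite (compR (esym (act_compr _ _ _ _))).
by rewrite -lunit_unit (lunit_nat f) mcompA isoVK mcompm1.
Qed.

Theorem theorem3p3 (k : fieldType) (C : braidedTensorCat k) (M : tensorCat k)
    (a : tensorModuleCat C M)
    (A : internalHom a (unit_ob M) (unit_ob M))
    (HF : central (induction_functor a)) :
  ihom_mult A ∘ braid (ihom_ob A) (ihom_ob A) = ihom_mult A.
Proof.
(* Naturality of [ihom_lam] moves the braiding inside it, as its image under the induction
   functor. *)
rewrite /ihom_mult -ind_mult_unit -ihom_nat; congr ihom_lam.
have := central_braid (induction_functor a) (ihom_ev A) (ihom_ev A) HF.
by rewrite /= !mcompA.
Qed.
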